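(* If a graph $G$ is $12$-representable by a $211$-avoiding word, then $G$ is a grounded $L$-graph.
   Context: All graphs are finite, simple and undirected. Let $[n]=\{1,\ldots,n\}$. For a word $w$ over positive integers, $\mathrm{red}(w)$ is the word obtained from $w$ by replacing each occurrence of the $i$th smallest letter with $i$. For a word (pattern) $p=p_1\cdots p_k$ with $\mathrm{red}(p)=p$, a word $w=w_1\cdots w_\ell$ contains $p$ if there are indices $i_1<\cdots<i_k$ with $\mathrm{red}(w_{i_1}\cdots w_{i_k})=p$; otherwise $w$ avoids $p$ (is $p$-avoiding). A labeled graph with vertex set $[n]$ is $12$-represented by a word $w$ over $[n]$ containing at least one copy of each letter of $[n]$ if for all $i<j$ in $[n]$: $i$ and $j$ are adjacent if and only if every occurrence of $j$ precedes every occurrence of $i$ in $w$. An (unlabeled) graph on $n$ vertices is $12$-representable by a $p$-avoiding word if its vertices can be labeled bijectively by $[n]$ so that the resulting labeled graph is $12$-represented by some $p$-avoiding word. An $L$-shape is the union of a vertical line segment and a horizontal line segment in the plane such that the bottom endpoint of the vertical segment coincides with the left endpoint of the horizontal segment. A grounded $L$-graph is the intersection graph of a family of $L$-shapes whose top endpoints (the top endpoints of their vertical segments) all lie on a common horizontal line. *)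

(* Defs.v *)
From mathcomp Require Import all_boot all_order all_algebra.
From mathcomp Require Import boolp classical_sets set_interval reals.

Set Implicit Arguments.
Unset Strict Implicit.
Unset Printing Implicit Defensive.

Import Order.TTheory GRing.Theory Num.Theory.

Local Open Scope ring_scope.
Local Open Scope classical_set_scope.

Definition red (w : seq nat) : seq nat :=
  [seq (index x (sort leq (undup w))).+1 | x <- w].

(* Only meant for reduced patterns, i.e. [red p = p]. *)
Definition contains_pattern (p w : seq nat) : Prop :=
  exists2 s : seq nat, subseq s w & red s = p.

Definition avoids_pattern (p w : seq nat) : Prop := ~ contains_pattern p w.

Definition all_before (a b : nat) (w : seq nat) : Prop :=
  forall k l : nat, (k < size w)%N -> (l < size w)%N ->
    nth 0%N w k = a -> nth 0%N w l = b -> (k < l)%N.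

(* The vertex set {1, .., n} is encoded as ['I_n], the ordinal [i] being the
   vertex [i.+1]; the letters of words are the labels 1, .., n themselves. *)
Definition represents12 (n : nat) (e : rel 'I_n) (w : seq nat) : Prop :=
  w =i iota 1 n /\
  forall i j : 'I_n, (i < j)%N -> (e i j <-> all_before j.+1 i.+1 w).

Definition representable12_avoiding (T : finType) (e : rel T) (p : seq nat) :
    Prop :=
  exists2 g : 'I_#|T| -> T, bijective g &
    exists2 w : seq nat, avoids_pattern p w & represents12 (relpre g e) w.

Record Lshape (R : realType) := MkLshape {
  Lx : R;
  Lbottom : R;
  Ltop : R;
  Lright : R;
  Lbottom_lt_top : Lbottom < Ltop;
  Lx_lt_right : Lx < Lright
}.

Definition Lset (R : realType) (L : Lshape R) : set (R * R) :=
  ([set Lx L] `*` `[Lbottom L, Ltop L]) `|`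
  (`[Lx L, Lright L] `*` [set Lbottom L]).

Definition grounded_Lgraph (R : realType) (T : finType) (e : rel T) : Prop :=
  exists L : T -> Lshape R,
    (exists h : R, forall v : T, Ltop (L v) = h) /\
    forall u v : T, u != v -> (e u v <-> Lset (L u) `&` Lset (L v) !=set0).

(* Main.v *)
Require Import Defs.
From mathcomp Require Import all_boot all_order all_algebra.
From mathcomp Require Import reals.
From mathcomp Require Import classical_sets.
From mathcomp Require Import zify lra.

(** Let [w] be a 211-avoiding word representing the graph, and let [a < b] be
    two of its letters.  If [a] is repeated in [w], no [b] can precede the first
    [a], as the two would form a copy of 211; hence [a] and [b] are not adjacent.
    If [a] occurs only once, every [b] precedes it exactly when the last [b]
    comes before the last [a].  So [a] and [b] are adjacent iff [a] occurs once
    and the last occurrences of [a] and [b] are inverted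
    ([all_before_avoiding211]).

    Grounded L-shapes realize exactly this kind of condition: the left one of
    two shapes meets the right one iff its horizontal segment is not deeper than
    the bottom of the right one and extends far enough to reach it
    ([Lset_meet]).  Hence place the shapes from left to right by increasing
    label, let the depth of a shape be the distance from the last occurrence of
    its letter to the end of [w], and let its horizontal segment pass all
    other shapes if the letter occurs once, and stop before the next shape if
    the letter is repeated. *)

Import Order.TTheory GRing.Theory Num.Theory.

Local Open Scope classical_set_scope.

Lemma red_211 (a b : nat) : a < b -> red [:: b; a; a] = [:: 2; 1; 1].
Proof.
move=> ltab; have neqab : (a == b) = false by lia.
have neqba : (b == a) = false by lia.
have -> : red [:: b; a; a] =
    [seq (index x (sort leq [:: b; a])).+1 | x <- [:: b; a; a]].
  by rewrite /red /= !inE eqxx neqba.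
have -> : sort leq [:: b; a] = [:: a; b].
  by rewrite /sort /=; have -> : (b <= a) = false by lia.
by rewrite /= !eqxx neqab.
Qed.

Lemma all_before_split (a b : nat) (s t : seq nat) : a != b -> a \notin s ->
  all_before b a (s ++ a :: t) <-> b \notin t.
Proof.
move=> neqab as_; split=> [before | bt k l ltk ltl].
  apply/negP => bt.
  have nth_b : nth 0 (s ++ a :: t) (size s + (index b t).+1) = b.
    by rewrite nth_cat ltnNge leq_addr /= addKn /= nth_index.
  have nth_a : nth 0 (s ++ a :: t) (size s) = a.
    by rewrite nth_cat ltnn subnn.
  have/before : size s + (index b t).+1 < size (s ++ a :: t).
    by rewrite size_cat ltn_add2l ltnS index_mem.
  have lts : size s < size (s ++ a :: t) by rewrite size_cat /=; lia.
  by move/(_ _ lts nth_b nth_a); lia.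
rewrite !nth_cat; case: ltnP => [ltks _ | leks].
  case: ltnP => [ltls nla | lels _]; last exact: leq_trans lels.
  by move: as_; rewrite -nla mem_nth.
move=> nkb; have : b \in a :: t.
  by rewrite -nkb mem_nth // ltn_subLR // -size_cat.
by rewrite inE eq_sym (negPf neqab) (negPf bt).
Qed.

(** [index x (rev w)] is the distance from the last occurrence of [x] in [w] to
    the end of [w]. *)
Lemma all_before_avoiding211 (w : seq nat) (a b : nat) :
  avoids_pattern [:: 2; 1; 1] w -> a \in w -> b \in w -> a < b ->
  all_before b a w <->
    count_mem a w = 1 /\ (index a (rev w) <= index b (rev w)).
Proof.
move=> avoid aw bw ltab; have neqab : a != b by lia.
(* After a cut at the first [a], both sides speak of the remainder of the word
   only: [b] must not occur in it, and [a] is repeated iff it occurs in it. *)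
have def_w : w = take (index a w) w ++ a :: drop (index a w).+1 w.
  rewrite -[in LHS](cat_take_drop (index a w) w) (drop_nth a) ?index_mem //.
  by rewrite nth_index.
have : a \notin take (index a w) w by rewrite in_take // ltnn.
move: def_w avoid bw; move: (take _ _) (drop _ _) => s t -> avoid bw as_.
rewrite all_before_split //.
have count_a : count_mem a (s ++ a :: t) = (count_mem a t).+1.
  by rewrite count_cat /= eqxx (count_memPn as_).
have [at_ | at_] := boolP (a \in t).
  split=> [bt | [one _]]; last first.
    by move: one; rewrite count_a => -[/count_memPn]; rewrite at_.
  case: avoid; exists [:: b; a; a]; last exact: red_211.
  have bs : b \in s.
    by move: bw; rewrite mem_cat inE (negPf bt) eq_sym (negPf neqab) !orbF.
  rewrite -(cat1s b); apply: cat_subseq; first by rewrite sub1seq.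
  by rewrite /= eqxx sub1seq.
have index_a : index a (rev (s ++ a :: t)) = size t.
  rewrite rev_cat rev_cons cat_rcons index_cat mem_rev (negPf at_) /= eqxx.
  by rewrite addn0 size_rev.
have le_index : (size t <= index b (rev (s ++ a :: t))) = (b \notin t).
  rewrite rev_cat rev_cons cat_rcons index_cat mem_rev.
  have [bt | _] := boolP (b \in t); last by rewrite size_rev leq_addr.
  by rewrite -(size_rev t) leqNgt index_mem mem_rev bt.
rewrite count_a index_a le_index (count_memPn at_).
by split=> [|[]].
Qed.

(** The common ground line makes the vertical segment of the right shape reach
    up past the horizontal segment of the left shape, so only the two conditions
    below remain for these segments to cross; no other pair of segments can meet
    unless they do. *)
Lemma Lset_meet (R : realType) (L M : Lshape R) :
  Ltop L = Ltop M -> (Lx L < Lx M)%R ->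
  Lset L `&` Lset M !=set0 <->
    (Lbottom M <= Lbottom L)%R /\ (Lx M <= Lright L)%R.
Proof.
move=> top ltx; have := Lbottom_lt_top L; have := Lx_lt_right M.
rewrite top => ltrM ltbL; split=> [[[x y] []] | [leb ler]].
  by rewrite /Lset /= !in_itv /= => -[] [+ +] -[] [+ +]; lra.
exists (Lx M, Lbottom L); rewrite /Lset /= !in_itv /=.
by split; [right | left]; split=> //; lra.
Qed.

Theorem corollary47 (R : realType) (T : finType) (e : rel T)
    (e_sym : symmetric e) (e_irr : irreflexive e) :
  representable12_avoiding e [:: 2; 1; 1] -> grounded_Lgraph R e.
Proof.
case=> g [label gK labelK] [w avoid [w_letters adj]].
pose a v := (label v).+1.
have a_le v : (a v <= #|T|) by exact: ltn_ord.
have a_in v : a v \in w by rewrite w_letters mem_iota add1n ltnS a_le.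
have edge u v : (a u < a v) ->
    e u v <-> count_mem (a u) w = 1 /\
              (index (a u) (rev w) <= index (a v) (rev w)).
  move=> ltuv; rewrite -all_before_avoiding211 //.
  by rewrite -adj //= !labelK.
(* Abscissae are doubled labels, so that an odd right end falls strictly
   between two consecutive shapes. *)
pose right v := (if count_mem (a v) w == 1 then #|T|.*2 else (a v).*2).+1.
have bottom_lt v : (- (index (a v) (rev w))%:R < 1 :> R)%R.
  by apply: (@le_lt_trans _ _ 0%R); rewrite ?oppr_le0 ?ler0n ?ltr01.
have x_lt v : ((a v).*2%:R < (right v)%:R :> R)%R.
  by rewrite ltr_nat /right; have := a_le v; case: ifP; lia.
pose L v := MkLshape (bottom_lt v) (x_lt v).
have meet u v : (a u < a v) -> e u v <-> Lset (L u) `&` Lset (L v) !=set0.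
  move=> ltuv; rewrite edge // Lset_meet //=; last by rewrite ltr_nat; lia.
  rewrite lerN2 !ler_nat /right; have := a_le v.
  by case: eqP => [one | many] lev; split=> -[? ?]; split=> //; lia.
exists L; split=> [|u v neq_uv]; first by exists 1%R.
have [/meet // | /meet + | eq_a] := ltngtP (a u) (a v).
  by rewrite e_sym setIC.
case/eqP: neq_uv; apply: (can_inj labelK); apply: val_inj.
by case: eq_a.
Qed.
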